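(* Let $\mathcal{C}$ be a bicategory and $\mathcal{W}$ a family of arrows of $\mathcal{C}$ containing the identities. Assume $\mathcal{W}$ satisfies the 3 for 2 property. Then any split arrow in $\mathcal{W}$ is mapped to an equivalence by the 2-functor $i:\mathcal{C}\to\mathcal{H}o(\mathcal{C},\mathcal{W})$.
   Context: **Conventions.** In a bicategory, $\circ$ is vertical composition of 2-cells and $*$ is horizontal composition ($g*f$ means first $f$, then $g$); an arrow also denotes its identity 2-cell, so $r*\alpha$ and $\alpha*\ell$ are whiskerings. By coherence, parentheses and identity arrows in horizontal composites of arrows are omitted, and associators and unitors are inserted tacitly. A 2-functor is a pseudofunctor between bicategories all of whose structural 2-cells are identities. An arrow $f:X\to Y$ is an equivalence if there are $g:Y\to X$ and invertible 2-cells $g*f\cong id_X$, $f*g\cong id_Y$; it is a quasiequivalence if for every object $Z$ the functors $f_*:\mathcal{C}(Z,X)\to\mathcal{C}(Z,Y)$ and $f^*:\mathcal{C}(Y,Z)\to\mathcal{C}(X,Z)$ are full and faithful. $\Theta_q$ denotes the family of quasiequivalences of a bicategory. Writing $F:(\mathcal{C},\mathcal{W})\to(\mathcal{D},\Gamma)$ means that $F$ maps the arrows of $\mathcal{W}$ into $\Gamma$. **Cylinders and homotopies.** A cylinder for $X\in\mathcal{C}$ (with respect to $\mathcal{W}$) is $C=(W,Z,d_0,d_1,x,s,\alpha_0,\alpha_1)$ with $d_0,d_1:X\to W$, $x:X\to Z$, $s:W\to Z$ an arrow in $\mathcal{W}$, and invertible 2-cells $\alpha_0:s*d_0\Rightarrow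 x$, $\alpha_1:s*d_1\Rightarrow x$; put $\alpha=\alpha_1^{-1}\circ\alpha_0:s*d_0\Rightarrow s*d_1$. For $f,g:X\to Y$, a homotopy $H$ from $f$ to $g$ is $H=(C,h,\eta,\varepsilon)$ with $C$ a cylinder for $X$, $h:W\to Y$ an arrow, and 2-cells $\eta:f\Rightarrow h*d_0$, $\varepsilon:h*d_1\Rightarrow g$ (not necessarily invertible). For $r:Y\to Y'$, $r*H$ is the homotopy from $r*f$ to $r*g$ with the same cylinder, arrow $r*h$ and 2-cells $r*\eta$, $r*\varepsilon$. For $\ell:X'\to X$, $H*\ell$ is the homotopy from $f*\ell$ to $g*\ell$ with cylinder $(W,Z,d_0*\ell,d_1*\ell,x*\ell,s,\alpha_0*\ell,\alpha_1*\ell)$, arrow $h$ and 2-cells $\eta*\ell$, $\varepsilon*\ell$. **The 2-cells $\widehat{FH}$.** For a 2-functor $F:(\mathcal{C},\mathcal{W})\to(\mathcal{D},\Theta_q)$, let $\widehat{FC}:Fd_0\Rightarrow Fd_1$ be the unique (invertible) 2-cell with $Fs*\widehat{FC}=F\alpha$, and let $\widehat{FH}=F\varepsilon\circ(Fh*\widehat{FC})\circ F\eta:Ff\Rightarrow Fg$. For a 2-cell $\mu:f\Rightarrow g$ of $\mathcal{C}$, $I^\mu$ denotes any homotopy from $f$ to $g$ with $\widehat{FI^\mu}=F\mu$ for every such 2-functor $F$; for instance one may take the homotopy with cylinder $(X,X,id_X,id_X,id_X,id_X,id,id)$, $h=g$, $\eta=\mu$, $\varepsilon=id_g$ (modulo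 unitors). **$\mathcal{H}o(\mathcal{C},\mathcal{W})$ and $i$.** The objects, arrows, identity arrows and composition of arrows are those of $\mathcal{C}$. A 2-cell $f\Rightarrow g$ is a class $[H^n,\dots,H^1]$ of a finite sequence of composable homotopies ($H^1$ from $f$ to $f_1$, $H^2$ from $f_1$ to $f_2$, ..., $H^n$ from $f_{n-1}$ to $g$), where $[H^n,\dots,H^1]=[K^m,\dots,K^1]$ iff $\widehat{FH^n}\circ\cdots\circ\widehat{FH^1}=\widehat{FK^m}\circ\cdots\circ\widehat{FK^1}$ for every bicategory $\mathcal{D}$ and every 2-functor $F:(\mathcal{C},\mathcal{W})\to(\mathcal{D},\Theta_q)$. Vertical composition is juxtaposition of sequences; the identity 2-cell of $f$ is $[I^{id_f}]$; whiskerings are $r*[H^n,\dots,H^1]=[r*H^n,\dots,r*H^1]$ and $[H^n,\dots,H^1]*\ell=[H^n*\ell,\dots,H^1*\ell]$, and these determine the horizontal composition. The 2-functor $i:\mathcal{C}\to\mathcal{H}o(\mathcal{C},\mathcal{W})$ is the identity on objects and arrows, and $i\mu=[I^\mu]$ on 2-cells; associators and unitors of $\mathcal{H}o(\mathcal{C},\mathcal{W})$ are the images under $i$ of those of $\mathcal{C}$. **3 for 2; split arrows.** $\mathcal{W}$ satisfies 3 for 2 if for every three arrows $f,g,h$ such that there is an invertible 2-cell $g*f\cong h$, whenever two of the three are in $\mathcal{W}$ so is the third. If $s:X\to Y$, $r:Y\to X$ and there is an invertible 2-cell $r*s\cong id_X$, then $s$ is called a section and $r$ a retraction. An arrow is split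 if it is a section or a retraction. *)

(* Defs.v *)
From Stdlib Require Import ssreflect ClassicalEpsilon Classical_Prop.
From Stdlib Require Import FunctionalExtensionality PropExtensionality.

Set Implicit Arguments.
Unset Strict Implicit.
Unset Printing Implicit Defensive.

Declare Scope bicat_scope.
Delimit Scope bicat_scope with bicat.
Local Open Scope bicat_scope.

(** Horizontal composition is presented by the two whiskerings; the horizontal
    composite of arbitrary 2-cells is [hcomp] below, and [exchange] is the
    interchange law in this presentation.  Both compositions are written in
    function order. *)
Record bicategory : Type := Bicategory {
  ob :> Type;
  hom : ob -> ob -> Type;
  cell : forall {X Y : ob}, hom X Y -> hom X Y -> Type;

  id1 : forall X : ob, hom X X;
  comp1 : forall {X Y Z : ob}, hom Y Z -> hom X Y -> hom X Z;

  id2 : forall {X Y : ob} (f : hom X Y), cell f f;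
  vcomp : forall {X Y : ob} {f g h : hom X Y}, cell g h -> cell f g -> cell f h;
  lwhisk : forall {X Y Z : ob} (r : hom Y Z) {f g : hom X Y},
    cell f g -> cell (comp1 r f) (comp1 r g);
  rwhisk : forall {X Y Z : ob} {f g : hom Y Z},
    cell f g -> forall l : hom X Y, cell (comp1 f l) (comp1 g l);

  assoc : forall {X Y Z T : ob} (h : hom Z T) (g : hom Y Z) (f : hom X Y),
    cell (comp1 (comp1 h g) f) (comp1 h (comp1 g f));
  assocV : forall {X Y Z T : ob} (h : hom Z T) (g : hom Y Z) (f : hom X Y),
    cell (comp1 h (comp1 g f)) (comp1 (comp1 h g) f);
  lunit : forall {X Y : ob} (f : hom X Y), cell (comp1 (id1 Y) f) f;
  lunitV : forall {X Y : ob} (f : hom X Y), cell f (comp1 (id1 Y) f);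
  runit : forall {X Y : ob} (f : hom X Y), cell (comp1 f (id1 X)) f;
  runitV : forall {X Y : ob} (f : hom X Y), cell f (comp1 f (id1 X));

  vcomp_idl : forall X Y (f g : hom X Y) (a : cell f g), vcomp (id2 g) a = a;
  vcomp_idr : forall X Y (f g : hom X Y) (a : cell f g), vcomp a (id2 f) = a;
  vcompA : forall X Y (f g h k : hom X Y)
      (c : cell h k) (b : cell g h) (a : cell f g),
    vcomp (vcomp c b) a = vcomp c (vcomp b a);

  lwhisk_id : forall X Y Z (r : hom Y Z) (f : hom X Y),
    lwhisk r (id2 f) = id2 (comp1 r f);
  lwhisk_comp : forall X Y Z (r : hom Y Z) (f g h : hom X Y)
      (b : cell g h) (a : cell f g),
    lwhisk r (vcomp b a) = vcomp (lwhisk r b) (lwhisk r a);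
  rwhisk_id : forall X Y Z (f : hom Y Z) (l : hom X Y),
    rwhisk (id2 f) l = id2 (comp1 f l);
  rwhisk_comp : forall X Y Z (f g h : hom Y Z)
      (b : cell g h) (a : cell f g) (l : hom X Y),
    rwhisk (vcomp b a) l = vcomp (rwhisk b l) (rwhisk a l);
  exchange : forall X Y Z (f f' : hom X Y) (g g' : hom Y Z)
      (b : cell g g') (a : cell f f'),
    vcomp (rwhisk b f') (lwhisk g a) = vcomp (lwhisk g' a) (rwhisk b f);

  assocK : forall X Y Z T (h : hom Z T) (g : hom Y Z) (f : hom X Y),
    vcomp (assocV h g f) (assoc h g f) = id2 _;
  assocVK : forall X Y Z T (h : hom Z T) (g : hom Y Z) (f : hom X Y),
    vcomp (assoc h g f) (assocV h g f) = id2 _;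
  lunitK : forall X Y (f : hom X Y), vcomp (lunitV f) (lunit f) = id2 _;
  lunitVK : forall X Y (f : hom X Y), vcomp (lunit f) (lunitV f) = id2 _;
  runitK : forall X Y (f : hom X Y), vcomp (runitV f) (runit f) = id2 _;
  runitVK : forall X Y (f : hom X Y), vcomp (runit f) (runitV f) = id2 _;

  assoc_lwhisk : forall X Y Z T (h : hom Z T) (g : hom Y Z) (f f' : hom X Y)
      (a : cell f f'),
    vcomp (assoc h g f') (lwhisk (comp1 h g) a)
    = vcomp (lwhisk h (lwhisk g a)) (assoc h g f);
  assoc_mwhisk : forall X Y Z T (h : hom Z T) (g g' : hom Y Z) (f : hom X Y)
      (b : cell g g'),
    vcomp (assoc h g' f) (rwhisk (lwhisk h b) f)
    = vcomp (lwhisk h (rwhisk b f)) (assoc h g f);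
  assoc_rwhisk : forall X Y Z T (h h' : hom Z T) (g : hom Y Z) (f : hom X Y)
      (c : cell h h'),
    vcomp (assoc h' g f) (rwhisk (rwhisk c g) f)
    = vcomp (rwhisk c (comp1 g f)) (assoc h g f);
  lunit_nat : forall X Y (f f' : hom X Y) (a : cell f f'),
    vcomp (lunit f') (lwhisk (id1 Y) a) = vcomp a (lunit f);
  runit_nat : forall X Y (f f' : hom X Y) (a : cell f f'),
    vcomp (runit f') (rwhisk a (id1 X)) = vcomp a (runit f);

  triangle : forall X Y Z (g : hom Y Z) (f : hom X Y),
    vcomp (lwhisk g (lunit f)) (assoc g (id1 Y) f) = rwhisk (runit g) f;
  pentagon : forall X Y Z T U
      (k : hom T U) (h : hom Z T) (g : hom Y Z) (f : hom X Y),
    vcomp (lwhisk k (assoc h g f))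
      (vcomp (assoc k (comp1 h g) f) (rwhisk (assoc k h g) f))
    = vcomp (assoc k h (comp1 g f)) (assoc (comp1 k h) g f)
}.

Arguments hom {C} X Y : rename.
Arguments cell {C X Y} f g : rename.
Arguments id1 {C} X : rename.
Arguments comp1 {C X Y Z} g f : rename.
Arguments id2 {C X Y} f : rename.
Arguments vcomp {C X Y f g h} b a : rename.
Arguments lwhisk {C X Y Z} r {f g} a : rename.
Arguments rwhisk {C X Y Z f g} a l : rename.
Arguments assoc {C X Y Z T} h g f : rename.
Arguments assocV {C X Y Z T} h g f : rename.
Arguments lunit {C X Y} f : rename.
Arguments lunitV {C X Y} f : rename.
Arguments runit {C X Y} f : rename.
Arguments runitV {C X Y} f : rename.

Notation "g ** f" := (comp1 g f) (at level 40, left associativity) : bicat_scope.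
Notation "f ==> g" := (cell f g) (at level 70, no associativity) : bicat_scope.
Notation "b \; a" := (vcomp b a) (at level 60, right associativity) : bicat_scope.
Notation "r <| a" := (lwhisk r a) (at level 45, no associativity) : bicat_scope.
Notation "a |> l" := (rwhisk a l) (at level 45, no associativity) : bicat_scope.

Definition hcomp (C : bicategory) (X Y Z : C) (f f' : hom X Y) (g g' : hom Y Z)
    (b : g ==> g') (a : f ==> f') : g ** f ==> g' ** f' :=
  (b |> f') \; (g <| a).

Record iso2 (C : bicategory) (X Y : C) (f g : hom X Y) : Type := Iso2 {
  fwd :> f ==> g;
  bwd : g ==> f;
  fwdK : bwd \; fwd = id2 f;
  bwdK : fwd \; bwd = id2 g
}.

Definition isomorphic2 (C : bicategory) (X Y : C) (f g : hom X Y) : Prop :=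
  inhabited (iso2 f g).

Definition iso2_id (C : bicategory) (X Y : C) (f : hom X Y) : iso2 f f :=
  @Iso2 C X Y f f (id2 f) (id2 f) (vcomp_idl _) (vcomp_idl _).

Definition lunit_iso (C : bicategory) (X Y : C) (f : hom X Y) :
    iso2 (id1 Y ** f) f :=
  Iso2 (lunitK f) (lunitVK f).

Definition is_equivalence (C : bicategory) (X Y : C) (f : hom X Y) : Prop :=
  exists g : hom Y X,
    isomorphic2 (g ** f) (id1 X) /\ isomorphic2 (f ** g) (id1 Y).

Definition bijective_map (A B : Type) (u : A -> B) : Prop :=
  (forall x y, u x = u y -> x = y) /\ (forall z, exists x, u x = z).

(** [postcomp_ff f] : the functor [f_* : C(Z,X) -> C(Z,Y)] is full and faithful
    for every [Z]; [precomp_ff f] is the same for [f^* : C(Y,Z) -> C(X,Z)]. *)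
Definition postcomp_ff (C : bicategory) (X Y : C) (f : hom X Y) : Prop :=
  forall (Z : C) (a b : hom Z X),
    bijective_map (fun t : a ==> b => f <| t).

Definition precomp_ff (C : bicategory) (X Y : C) (f : hom X Y) : Prop :=
  forall (Z : C) (a b : hom Y Z),
    bijective_map (fun t : a ==> b => t |> f).

Definition is_quasiequivalence (C : bicategory) (X Y : C) (f : hom X Y) : Prop :=
  postcomp_ff f /\ precomp_ff f.

Definition arrow_family (C : bicategory) : Type :=
  forall X Y : C, hom X Y -> Prop.

Definition quasiequivalences (C : bicategory) : arrow_family C :=
  fun X Y f => is_quasiequivalence f.

Definition contains_identities (C : bicategory) (W : arrow_family C) : Prop :=
  forall X : C, W X X (id1 X).

Definition three_for_two (C : bicategory) (W : arrow_family C) : Prop :=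
  forall (X Y Z : C) (f : hom X Y) (g : hom Y Z) (h : hom X Z),
    isomorphic2 (g ** f) h ->
    (W _ _ f -> W _ _ g -> W _ _ h) /\
    (W _ _ f -> W _ _ h -> W _ _ g) /\
    (W _ _ g -> W _ _ h -> W _ _ f).

Definition is_section (C : bicategory) (X Y : C) (s : hom X Y) : Prop :=
  exists r : hom Y X, isomorphic2 (r ** s) (id1 X).

Definition is_retraction (C : bicategory) (X Y : C) (r : hom X Y) : Prop :=
  exists s : hom Y X, isomorphic2 (r ** s) (id1 Y).

Definition is_split (C : bicategory) (X Y : C) (f : hom X Y) : Prop :=
  is_section f \/ is_retraction f.

Record pseudofunctor (C D : bicategory) : Type := Pseudofunctor {
  F0 :> C -> D;
  F1 : forall {X Y : C}, hom X Y -> hom (F0 X) (F0 Y);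
  F2 : forall {X Y : C} {f g : hom X Y}, f ==> g -> F1 f ==> F1 g;
  Fcomp : forall {X Y Z : C} (g : hom Y Z) (f : hom X Y),
    iso2 (F1 g ** F1 f) (F1 (g ** f));
  Fid : forall X : C, iso2 (id1 (F0 X)) (F1 (id1 X));

  F2_id : forall (X Y : C) (f : hom X Y), F2 (id2 f) = id2 (F1 f);
  F2_comp : forall (X Y : C) (f g h : hom X Y) (b : g ==> h) (a : f ==> g),
    F2 (b \; a) = F2 b \; F2 a;
  Fcomp_lwhisk : forall (X Y Z : C) (g : hom Y Z) (f f' : hom X Y)
      (a : f ==> f'),
    F2 (g <| a) \; Fcomp g f = Fcomp g f' \; (F1 g <| F2 a);
  Fcomp_rwhisk : forall (X Y Z : C) (g g' : hom Y Z) (f : hom X Y)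
      (b : g ==> g'),
    F2 (b |> f) \; Fcomp g f = Fcomp g' f \; (F2 b |> F1 f);
  F2_assoc : forall (X Y Z T : C) (h : hom Z T) (g : hom Y Z) (f : hom X Y),
    F2 (assoc h g f) \; Fcomp (h ** g) f \; (Fcomp h g |> F1 f)
    = Fcomp h (g ** f) \; (F1 h <| Fcomp g f) \; assoc (F1 h) (F1 g) (F1 f);
  F2_lunit : forall (X Y : C) (f : hom X Y),
    F2 (lunit f) \; Fcomp (id1 Y) f \; (Fid Y |> F1 f) = lunit (F1 f);
  F2_runit : forall (X Y : C) (f : hom X Y),
    F2 (runit f) \; Fcomp f (id1 X) \; (F1 f <| Fid X) = runit (F1 f)
}.

Arguments F1 {C D} F {X Y} f : rename.
Arguments F2 {C D} F {X Y f g} a : rename.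
Arguments Fcomp {C D} F {X Y Z} g f : rename.
Arguments Fid {C D} F X : rename.

(** [is_identity2 a] : the 2-cell [a] is an identity; in particular its source
    and target arrows are equal. *)
Inductive is_identity2 (C : bicategory) (X Y : C) (f : hom X Y) :
    forall g : hom X Y, f ==> g -> Prop :=
  | IsIdentity2 : is_identity2 (id2 f).

Record two_functor (C D : bicategory) : Type := TwoFunctor {
  pseudo :> pseudofunctor C D;
  Fcomp_strict : forall (X Y Z : C) (g : hom Y Z) (f : hom X Y),
    is_identity2 (Fcomp pseudo g f);
  Fid_strict : forall X : C, is_identity2 (Fid pseudo X)
}.

Definition maps_into (C D : bicategory) (F : two_functor C D)
    (W : arrow_family C) (G : arrow_family D) : Prop :=
  forall (X Y : C) (f : hom X Y), W X Y f -> G (F X) (F Y) (F1 F f).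

Record cylinder (C : bicategory) (W : arrow_family C) (X : C) : Type := Cylinder {
  cylW : C;
  cylZ : C;
  d0 : hom X cylW;
  d1 : hom X cylW;
  cylx : hom X cylZ;
  cyls : hom cylW cylZ;
  alpha0 : iso2 (cyls ** d0) cylx;
  alpha1 : iso2 (cyls ** d1) cylx;
  cyls_in : W _ _ cyls
}.

Definition alpha (C : bicategory) (W : arrow_family C) (X : C)
    (K : cylinder W X) : cyls K ** d0 K ==> cyls K ** d1 K :=
  bwd (alpha1 K) \; alpha0 K.

Record homotopy (C : bicategory) (W : arrow_family C) (X Y : C)
    (f g : hom X Y) : Type := Homotopy {
  hcyl : cylinder W X;
  hmap : hom (cylW hcyl) Y;
  heta : f ==> hmap ** d0 hcyl;
  heps : hmap ** d1 hcyl ==> g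
}.

Definition homotopy_lwhisk (C : bicategory) (W : arrow_family C) (X Y Y' : C)
    (r : hom Y Y') (f g : hom X Y) (H : homotopy W f g) :
    homotopy W (r ** f) (r ** g) :=
  @Homotopy C W X Y' _ _ (hcyl H) (r ** hmap H)
    (assocV r (hmap H) (d0 (hcyl H)) \; (r <| heta H))
    ((r <| heps H) \; assoc r (hmap H) (d1 (hcyl H))).

Lemma rwhisk_isoK (C : bicategory) (X' X Y Z : C) (s : hom Y Z) (d : hom X Y)
    (x : hom X Z) (a : iso2 (s ** d) x) (l : hom X' X) :
  (assoc s d l \; (bwd a |> l)) \; ((a |> l) \; assocV s d l) = id2 _.
Proof.
rewrite vcompA -(vcompA (bwd a |> l)) -rwhisk_comp fwdK rwhisk_id vcomp_idl.
exact: assocVK.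
Qed.

Lemma rwhisk_isoVK (C : bicategory) (X' X Y Z : C) (s : hom Y Z) (d : hom X Y)
    (x : hom X Z) (a : iso2 (s ** d) x) (l : hom X' X) :
  ((a |> l) \; assocV s d l) \; (assoc s d l \; (bwd a |> l)) = id2 _.
Proof.
rewrite vcompA -(vcompA (assocV s d l)) assocK vcomp_idl -rwhisk_comp bwdK.
exact: rwhisk_id.
Qed.

Definition rwhisk_iso (C : bicategory) (X' X Y Z : C) (s : hom Y Z)
    (d : hom X Y) (x : hom X Z) (a : iso2 (s ** d) x) (l : hom X' X) :
    iso2 (s ** (d ** l)) (x ** l) :=
  Iso2 (rwhisk_isoK a l) (rwhisk_isoVK a l).

Definition cylinder_rwhisk (C : bicategory) (W : arrow_family C) (X' X : C)
    (K : cylinder W X) (l : hom X' X) : cylinder W X' :=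
  @Cylinder C W X' (cylW K) (cylZ K) (d0 K ** l) (d1 K ** l) (cylx K ** l)
    (cyls K) (rwhisk_iso (alpha0 K) l) (rwhisk_iso (alpha1 K) l) (cyls_in K).

Definition homotopy_rwhisk (C : bicategory) (W : arrow_family C) (X' X Y : C)
    (f g : hom X Y) (H : homotopy W f g) (l : hom X' X) :
    homotopy W (f ** l) (g ** l) :=
  @Homotopy C W X' Y _ _ (cylinder_rwhisk (hcyl H) l) (hmap H)
    (assoc (hmap H) (d0 (hcyl H)) l \; (heta H |> l))
    ((heps H |> l) \; assocV (hmap H) (d1 (hcyl H)) l).

Definition trivial_cylinder (C : bicategory) (W : arrow_family C)
    (Wid : contains_identities W) (X : C) : cylinder W X :=
  @Cylinder C W X X X (id1 X) (id1 X) (id1 X) (id1 X)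
    (lunit_iso (id1 X)) (lunit_iso (id1 X)) (Wid X).

(** One choice of [I^mu]; by [hat_cell_homotopy] it has the property that
    determines its class. *)
Definition cell_homotopy (C : bicategory) (W : arrow_family C)
    (Wid : contains_identities W) (X Y : C) (f g : hom X Y) (mu : f ==> g) :
    homotopy W f g :=
  @Homotopy C W X Y f g (trivial_cylinder Wid X) g
    (runitV g \; mu) (runit g).

(** Nonempty finite sequences of composable homotopies; [seq_cons H s] is
    [[H, H^n, ..., H^1]] for [s = [H^n, ..., H^1]]. *)
Inductive homotopy_seq (C : bicategory) (W : arrow_family C) (X Y : C)
    (f : hom X Y) : hom X Y -> Type :=
  | seq_one : forall g, homotopy W f g -> homotopy_seq W f g
  | seq_cons : forall g h,
      homotopy W g h -> homotopy_seq W f g -> homotopy_seq W f h.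

Arguments seq_one {C W X Y f g} _.
Arguments seq_cons {C W X Y f g h} _ _.

Fixpoint seq_cat (C : bicategory) (W : arrow_family C) (X Y : C)
    (f g h : hom X Y) (t : homotopy_seq W g h) :
    homotopy_seq W f g -> homotopy_seq W f h :=
  match t in homotopy_seq _ _ k
    return homotopy_seq W f g -> homotopy_seq W f k with
  | seq_one H => fun s => seq_cons H s
  | seq_cons H t' => fun s => seq_cons H (seq_cat t' s)
  end.

Fixpoint seq_lwhisk (C : bicategory) (W : arrow_family C) (X Y Y' : C)
    (r : hom Y Y') (f g : hom X Y) (s : homotopy_seq W f g) :
    homotopy_seq W (r ** f) (r ** g) :=
  match s in homotopy_seq _ _ k return homotopy_seq W (r ** f) (r ** k) with
  | seq_one H => seq_one (homotopy_lwhisk r H)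
  | seq_cons H s' => seq_cons (homotopy_lwhisk r H) (seq_lwhisk r s')
  end.

Fixpoint seq_rwhisk (C : bicategory) (W : arrow_family C) (X' X Y : C)
    (f g : hom X Y) (s : homotopy_seq W f g) (l : hom X' X) :
    homotopy_seq W (f ** l) (g ** l) :=
  match s in homotopy_seq _ _ k return homotopy_seq W (f ** l) (k ** l) with
  | seq_one H => seq_one (homotopy_rwhisk H l)
  | seq_cons H s' => seq_cons (homotopy_rwhisk H l) (seq_rwhisk s' l)
  end.

(** The equation [Fs * t = F alpha].  Since [F] is a 2-functor, [F s ** F d]
    and [F (s ** d)] are equal and [Fcomp F s d] is an identity 2-cell, which
    here replaces transport along that equality.  The same applies to
    [hat_homotopy] below. *)
Definition is_hat_cylinder (C D : bicategory) (W : arrow_family C)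
    (F : two_functor C D) (X : C) (K : cylinder W X)
    (t : F1 F (d0 K) ==> F1 F (d1 K)) : Prop :=
  F1 F (cyls K) <| t
  = bwd (Fcomp F (cyls K) (d1 K)) \; F2 F (alpha K) \; Fcomp F (cyls K) (d0 K).

Lemma hat_cylinder_exists (C D : bicategory) (W : arrow_family C)
    (F : two_functor C D) (FW : maps_into F W (@quasiequivalences D))
    (X : C) (K : cylinder W X) :
  exists t, is_hat_cylinder (F := F) (K := K) t.
Proof.
have [post _] := FW _ _ _ (cyls_in K).
have [_ full] := post _ (F1 F (d0 K)) (F1 F (d1 K)).
exact: full.
Qed.

Lemma hat_cylinder_unique (C D : bicategory) (W : arrow_family C)
    (F : two_functor C D) (FW : maps_into F W (@quasiequivalences D))
    (X : C) (K : cylinder W X) t t' :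
  is_hat_cylinder (F := F) (K := K) t -> is_hat_cylinder (F := F) (K := K) t' ->
  t = t'.
Proof.
move=> et et'.
have [post _] := FW _ _ _ (cyls_in K).
have [faithful _] := post _ (F1 F (d0 K)) (F1 F (d1 K)).
by apply: faithful; rewrite et et'.
Qed.

Definition hat_cylinder (C D : bicategory) (W : arrow_family C)
    (F : two_functor C D) (FW : maps_into F W (@quasiequivalences D))
    (X : C) (K : cylinder W X) : F1 F (d0 K) ==> F1 F (d1 K) :=
  proj1_sig (constructive_indefinite_description _ (hat_cylinder_exists FW K)).

Lemma hat_cylinderP (C D : bicategory) (W : arrow_family C)
    (F : two_functor C D) (FW : maps_into F W (@quasiequivalences D))
    (X : C) (K : cylinder W X) : is_hat_cylinder (hat_cylinder FW K).
Proof.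
exact: (proj2_sig
  (constructive_indefinite_description _ (hat_cylinder_exists FW K))).
Qed.

Definition hat_homotopy (C D : bicategory) (W : arrow_family C)
    (F : two_functor C D) (FW : maps_into F W (@quasiequivalences D))
    (X Y : C) (f g : hom X Y) (H : homotopy W f g) : F1 F f ==> F1 F g :=
  F2 F (heps H)
  \; (Fcomp F (hmap H) (d1 (hcyl H))
      \; (F1 F (hmap H) <| hat_cylinder FW (hcyl H))
      \; bwd (Fcomp F (hmap H) (d0 (hcyl H))))
  \; F2 F (heta H).

Fixpoint hat_seq (C D : bicategory) (W : arrow_family C)
    (F : two_functor C D) (FW : maps_into F W (@quasiequivalences D))
    (X Y : C) (f g : hom X Y) (s : homotopy_seq W f g) : F1 F f ==> F1 F g :=
  match s in homotopy_seq _ _ k return F1 F f ==> F1 F k with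
  | seq_one H => hat_homotopy FW H
  | seq_cons H s' => hat_homotopy FW H \; hat_seq FW s'
  end.

(** The quantifier over [D] lives in [Prop], so that [Ho] below is again a
    [bicategory]; [D] ranges over bicategories at the universe levels of [C]. *)
Definition seq_equiv (C : bicategory) (W : arrow_family C) (X Y : C)
    (f g : hom X Y) (s t : homotopy_seq W f g) : Prop :=
  forall (D : bicategory) (F : two_functor C D)
         (FW : maps_into F W (@quasiequivalences D)),
    hat_seq FW s = hat_seq FW t.

Definition quotient (T : Type) (R : T -> T -> Prop) : Type :=
  { P : T -> Prop | exists x, P = R x }.

Definition class_of (T : Type) (R : T -> T -> Prop) (x : T) : quotient R :=
  exist (fun P => exists x, P = R x) (R x) (ex_intro _ x eq_refl).

Definition repr (T : Type) (R : T -> T -> Prop) (q : quotient R) : T :=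
  proj1_sig (constructive_indefinite_description _ (proj2_sig q)).

Lemma reprK (T : Type) (R : T -> T -> Prop) (q : quotient R) :
  class_of R (repr q) = q.
Proof.
have e := proj2_sig (constructive_indefinite_description _ (proj2_sig q)).
rewrite -/(repr q) in e.
case: q e => P HP /= e.
apply: eq_sig_hprop => [Q|]; first exact: proof_irrelevance.
by rewrite /= -e.
Qed.

Lemma eq_class (T : Type) (R : T -> T -> Prop)
    (Rrefl : forall x, R x x) (Rsym : forall x y, R x y -> R y x)
    (Rtrans : forall x y z, R x y -> R y z -> R x z) (x y : T) :
  class_of R x = class_of R y <-> R x y.
Proof.
split=> [[e]|xy]; first by rewrite e; exact: Rrefl.
apply: eq_sig_hprop => [Q|/=]; first exact: proof_irrelevance.
apply: functional_extensionality => z; apply: propositional_extensionality.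
by split; [apply: Rtrans; exact: Rsym | exact: Rtrans].
Qed.

Lemma vcomp_tail (C : bicategory) (X Y : C) (f g h : hom X Y)
    (b : g ==> h) (a : f ==> g) (c : f ==> h) :
  b \; a = c -> forall (k : hom X Y) (t : k ==> f), b \; a \; t = c \; t.
Proof. by move=> <- k t; rewrite vcompA. Qed.

Lemma iso2_epi (C : bicategory) (X Y : C) (f g h : hom X Y) (u : iso2 f g)
    (a b : g ==> h) : a \; u = b \; u -> a = b.
Proof.
by move=> e; rewrite -(vcomp_idr a) -(vcomp_idr b) -(bwdK u) -!vcompA e.
Qed.

Definition lwhisk_iso2 (C : bicategory) (X Y Z : C) (r : hom Y Z)
    (f g : hom X Y) (u : iso2 f g) : iso2 (r ** f) (r ** g).
Proof.
apply: (@Iso2 C X Z _ _ (r <| u) (r <| bwd u)).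
- by rewrite -lwhisk_comp fwdK lwhisk_id.
- by rewrite -lwhisk_comp bwdK lwhisk_id.
Defined.

Definition rwhisk_iso2 (C : bicategory) (X Y Z : C) (f g : hom Y Z)
    (u : iso2 f g) (l : hom X Y) : iso2 (f ** l) (g ** l).
Proof.
apply: (@Iso2 C X Z _ _ (u |> l) (bwd u |> l)).
- by rewrite -rwhisk_comp fwdK rwhisk_id.
- by rewrite -rwhisk_comp bwdK rwhisk_id.
Defined.

Definition Flwhisk (C D : bicategory) (F : pseudofunctor C D) (X Y Z : C)
    (r : hom Y Z) (f g : hom X Y) (t : F1 F f ==> F1 F g) :
    F1 F (r ** f) ==> F1 F (r ** g) :=
  locked (Fcomp F r g \; (F1 F r <| t) \; bwd (Fcomp F r f)).

Definition Frwhisk (C D : bicategory) (F : pseudofunctor C D) (X Y Z : C)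
    (f g : hom Y Z) (t : F1 F f ==> F1 F g) (l : hom X Y) :
    F1 F (f ** l) ==> F1 F (g ** l) :=
  locked (Fcomp F g l \; (t |> F1 F l) \; bwd (Fcomp F f l)).

Lemma FlwhiskE (C D : bicategory) (F : pseudofunctor C D) (X Y Z : C)
    (r : hom Y Z) (f g : hom X Y) (t : F1 F f ==> F1 F g) :
  Flwhisk r t = Fcomp F r g \; (F1 F r <| t) \; bwd (Fcomp F r f).
Proof. by rewrite /Flwhisk -lock. Qed.

Lemma Flwhisk_Fcomp (C D : bicategory) (F : pseudofunctor C D) (X Y Z : C)
    (r : hom Y Z) (f g : hom X Y) (t : F1 F f ==> F1 F g) :
  Flwhisk r t \; Fcomp F r f = Fcomp F r g \; (F1 F r <| t).
Proof. by rewrite /Flwhisk -lock !vcompA fwdK vcomp_idr. Qed.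

Lemma Frwhisk_Fcomp (C D : bicategory) (F : pseudofunctor C D) (X Y Z : C)
    (f g : hom Y Z) (t : F1 F f ==> F1 F g) (l : hom X Y) :
  Frwhisk t l \; Fcomp F f l = Fcomp F g l \; (t |> F1 F l).
Proof. by rewrite /Frwhisk -lock !vcompA fwdK vcomp_idr. Qed.

Lemma Flwhisk_F2 (C D : bicategory) (F : pseudofunctor C D) (X Y Z : C)
    (r : hom Y Z) (f g : hom X Y) (a : f ==> g) :
  Flwhisk r (F2 F a) = F2 F (r <| a).
Proof.
by apply: (iso2_epi (u := Fcomp F r f)); rewrite Flwhisk_Fcomp Fcomp_lwhisk.
Qed.

Lemma Frwhisk_F2 (C D : bicategory) (F : pseudofunctor C D) (X Y Z : C)
    (f g : hom Y Z) (a : f ==> g) (l : hom X Y) :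
  Frwhisk (F2 F a) l = F2 F (a |> l).
Proof.
by apply: (iso2_epi (u := Fcomp F f l)); rewrite Frwhisk_Fcomp Fcomp_rwhisk.
Qed.

Lemma Flwhisk_comp (C D : bicategory) (F : pseudofunctor C D) (X Y Z : C)
    (r : hom Y Z) (f g h : hom X Y)
    (u : F1 F g ==> F1 F h) (t : F1 F f ==> F1 F g) :
  Flwhisk r (u \; t) = Flwhisk r u \; Flwhisk r t.
Proof.
apply: (iso2_epi (u := Fcomp F r f)).
by rewrite vcompA !Flwhisk_Fcomp -vcompA Flwhisk_Fcomp lwhisk_comp vcompA.
Qed.

Lemma Frwhisk_comp (C D : bicategory) (F : pseudofunctor C D) (X Y Z : C)
    (f g h : hom Y Z) (u : F1 F g ==> F1 F h) (t : F1 F f ==> F1 F g)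
    (l : hom X Y) :
  Frwhisk (u \; t) l = Frwhisk u l \; Frwhisk t l.
Proof.
apply: (iso2_epi (u := Fcomp F f l)).
by rewrite vcompA !Frwhisk_Fcomp -vcompA Frwhisk_Fcomp rwhisk_comp vcompA.
Qed.

Lemma F_exchange (C D : bicategory) (F : pseudofunctor C D) (X Y Z : C)
    (f f' : hom X Y) (g g' : hom Y Z)
    (u : F1 F g ==> F1 F g') (t : F1 F f ==> F1 F f') :
  Frwhisk u f' \; Flwhisk g t = Flwhisk g' t \; Frwhisk u f.
Proof.
apply: (iso2_epi (u := Fcomp F g f)).
rewrite !vcompA Flwhisk_Fcomp Frwhisk_Fcomp.
by rewrite -!vcompA Flwhisk_Fcomp Frwhisk_Fcomp !vcompA exchange.
Qed.

Lemma F_lunit_nat (C D : bicategory) (F : pseudofunctor C D) (X Y : C)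
    (f f' : hom X Y) (t : F1 F f ==> F1 F f') :
  F2 F (lunit f') \; Flwhisk (id1 Y) t = t \; F2 F (lunit f).
Proof.
apply: (iso2_epi (u := Fcomp F (id1 Y) f)).
apply: (iso2_epi (u := rwhisk_iso2 (Fid F Y) (F1 F f))) => /=.
rewrite !vcompA F2_lunit (vcomp_tail (Flwhisk_Fcomp _ _)) !vcompA -exchange.
by rewrite -lunit_nat -F2_lunit !vcompA.
Qed.

Lemma F_runit_nat (C D : bicategory) (F : pseudofunctor C D) (X Y : C)
    (f f' : hom X Y) (t : F1 F f ==> F1 F f') :
  F2 F (runit f') \; Frwhisk t (id1 X) = t \; F2 F (runit f).
Proof.
apply: (iso2_epi (u := Fcomp F f (id1 X))).
apply: (iso2_epi (u := lwhisk_iso2 (F1 F f) (Fid F X))) => /=.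
rewrite !vcompA F2_runit (vcomp_tail (Frwhisk_Fcomp _ _)) !vcompA exchange.
by rewrite -runit_nat -F2_runit !vcompA.
Qed.

Lemma F_assoc_lwhisk (C D : bicategory) (F : pseudofunctor C D) (X Y Z T : C)
    (h : hom Z T) (g : hom Y Z) (f f' : hom X Y) (t : F1 F f ==> F1 F f') :
  F2 F (assoc h g f') \; Flwhisk (h ** g) t
  = Flwhisk h (Flwhisk g t) \; F2 F (assoc h g f).
Proof.
apply: (iso2_epi (u := Fcomp F (h ** g) f)).
apply: (iso2_epi (u := rwhisk_iso2 (Fcomp F h g) (F1 F f))) => /=.
rewrite !vcompA F2_assoc (vcomp_tail (Flwhisk_Fcomp _ _)) !vcompA -exchange.
have := F2_assoc F h g f'; rewrite -!vcompA => ->; rewrite !vcompA.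
rewrite assoc_lwhisk (vcomp_tail (Flwhisk_Fcomp _ _)) !vcompA; congr (_ \; _).
by rewrite -!vcompA -!lwhisk_comp Flwhisk_Fcomp.
Qed.

Lemma F_assoc_mwhisk (C D : bicategory) (F : pseudofunctor C D) (X Y Z T : C)
    (h : hom Z T) (g g' : hom Y Z) (f : hom X Y) (t : F1 F g ==> F1 F g') :
  F2 F (assoc h g' f) \; Frwhisk (Flwhisk h t) f
  = Flwhisk h (Frwhisk t f) \; F2 F (assoc h g f).
Proof.
apply: (iso2_epi (u := Fcomp F (h ** g) f)).
apply: (iso2_epi (u := rwhisk_iso2 (Fcomp F h g) (F1 F f))) => /=.
rewrite !vcompA F2_assoc (vcomp_tail (Frwhisk_Fcomp _ _)) !vcompA.
rewrite -rwhisk_comp Flwhisk_Fcomp rwhisk_comp.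
have := F2_assoc F h g' f; rewrite -!vcompA => ->; rewrite !vcompA.
rewrite assoc_mwhisk (vcomp_tail (Flwhisk_Fcomp _ _)) !vcompA; congr (_ \; _).
by rewrite -!vcompA -!lwhisk_comp Frwhisk_Fcomp.
Qed.

Lemma F_assoc_rwhisk (C D : bicategory) (F : pseudofunctor C D) (X Y Z T : C)
    (h h' : hom Z T) (g : hom Y Z) (f : hom X Y) (t : F1 F h ==> F1 F h') :
  F2 F (assoc h' g f) \; Frwhisk (Frwhisk t g) f
  = Frwhisk t (g ** f) \; F2 F (assoc h g f).
Proof.
apply: (iso2_epi (u := Fcomp F (h ** g) f)).
apply: (iso2_epi (u := rwhisk_iso2 (Fcomp F h g) (F1 F f))) => /=.
rewrite !vcompA F2_assoc (vcomp_tail (Frwhisk_Fcomp _ _)) !vcompA.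
rewrite -rwhisk_comp Frwhisk_Fcomp rwhisk_comp.
have := F2_assoc F h' g f; rewrite -!vcompA => ->; rewrite !vcompA.
rewrite assoc_rwhisk (vcomp_tail (Frwhisk_Fcomp _ _)) !vcompA; congr (_ \; _).
by rewrite -!vcompA exchange.
Qed.

Lemma vcomp_cancel (C : bicategory) (X Y : C) (f g h : hom X Y)
    (b : g ==> h) (a : h ==> g) :
  b \; a = id2 h -> forall t : f ==> h, b \; a \; t = t.
Proof. by move=> e t; rewrite -vcompA e vcomp_idl. Qed.

Lemma F2_assocK (C D : bicategory) (F : pseudofunctor C D) (X Y Z T : C)
    (h : hom Z T) (g : hom Y Z) (f : hom X Y) :
  F2 F (assocV h g f) \; F2 F (assoc h g f) = id2 _.
Proof. by rewrite -F2_comp assocK F2_id. Qed.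

Lemma F2_assocVK (C D : bicategory) (F : pseudofunctor C D) (X Y Z T : C)
    (h : hom Z T) (g : hom Y Z) (f : hom X Y) :
  F2 F (assoc h g f) \; F2 F (assocV h g f) = id2 _.
Proof. by rewrite -F2_comp assocVK F2_id. Qed.

Lemma hat_homotopy_lwhisk (C D : bicategory) (W : arrow_family C)
    (F : two_functor C D) (FW : maps_into F W (@quasiequivalences D))
    (X Y Y' : C) (r : hom Y Y') (f g : hom X Y) (H : homotopy W f g) :
  hat_homotopy FW (homotopy_lwhisk r H) = Flwhisk r (hat_homotopy FW H).
Proof.
rewrite /hat_homotopy /= -!FlwhiskE !F2_comp !Flwhisk_comp !Flwhisk_F2.
rewrite !vcompA; congr (_ \; _).
rewrite (vcomp_tail (F_assoc_lwhisk _ _ _)) !vcompA; congr (_ \; _).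
by rewrite (vcomp_cancel (F2_assocVK _ _ _ _)).
Qed.

Lemma hat_cylinder_rwhisk (C D : bicategory) (W : arrow_family C)
    (F : two_functor C D) (FW : maps_into F W (@quasiequivalences D))
    (X' X : C) (K : cylinder W X) (l : hom X' X) :
  hat_cylinder FW (cylinder_rwhisk K l) = Frwhisk (hat_cylinder FW K) l.
Proof.
apply: (hat_cylinder_unique FW); first exact: hat_cylinderP.
have e : F2 F (alpha K) = Flwhisk (cyls K) (hat_cylinder FW K).
  have := hat_cylinderP FW K; rewrite FlwhiskE /is_hat_cylinder => ->.
  rewrite !vcompA bwdK vcomp_idr.
  by rewrite (vcomp_cancel (bwdK _)).
have e' : alpha (cylinder_rwhisk K l)
    = assoc (cyls K) (d1 K) l \; (alpha K |> l) \; assocV (cyls K) (d0 K) l.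
  by rewrite /alpha /= rwhisk_comp !vcompA.
rewrite /is_hat_cylinder e' !F2_comp -Frwhisk_F2 e.
rewrite (vcomp_tail (F_assoc_mwhisk _ _ _)) !vcompA /=.
rewrite (vcomp_cancel (F2_assocVK _ _ _ _)) Flwhisk_Fcomp.
by rewrite (vcomp_cancel (fwdK _)).
Qed.

Lemma hat_homotopy_rwhisk (C D : bicategory) (W : arrow_family C)
    (F : two_functor C D) (FW : maps_into F W (@quasiequivalences D))
    (X' X Y : C) (f g : hom X Y) (H : homotopy W f g) (l : hom X' X) :
  hat_homotopy FW (homotopy_rwhisk H l) = Frwhisk (hat_homotopy FW H) l.
Proof.
rewrite /hat_homotopy /= -!FlwhiskE !F2_comp !Frwhisk_comp !Frwhisk_F2.
rewrite !vcompA; congr (_ \; _).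
rewrite hat_cylinder_rwhisk (vcomp_tail (eq_sym (F_assoc_mwhisk _ _ _))) !vcompA.
by rewrite (vcomp_cancel (F2_assocK _ _ _ _)).
Qed.

Lemma hat_cell_homotopy (C D : bicategory) (W : arrow_family C)
    (Wid : contains_identities W)
    (F : two_functor C D) (FW : maps_into F W (@quasiequivalences D))
    (X Y : C) (f g : hom X Y) (mu : f ==> g) :
  hat_homotopy FW (cell_homotopy Wid mu) = F2 F mu.
Proof.
have e : hat_cylinder FW (trivial_cylinder Wid X) = id2 _.
  apply: (hat_cylinder_unique FW); first exact: hat_cylinderP.
  rewrite /is_hat_cylinder /alpha /= lunitK F2_id lwhisk_id vcomp_idl.
  by rewrite fwdK.
rewrite /hat_homotopy /= e lwhisk_id vcomp_idl bwdK vcomp_idl F2_comp.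
by rewrite -vcompA -F2_comp runitVK F2_id vcomp_idl.
Qed.

Lemma hat_seq_cat (C D : bicategory) (W : arrow_family C)
    (F : two_functor C D) (FW : maps_into F W (@quasiequivalences D))
    (X Y : C) (f g h : hom X Y) (t : homotopy_seq W g h)
    (s : homotopy_seq W f g) :
  hat_seq FW (seq_cat t s) = hat_seq FW t \; hat_seq FW s.
Proof. by elim: t s => //= k l H t IH s; rewrite IH vcompA. Qed.

Lemma hat_seq_lwhisk (C D : bicategory) (W : arrow_family C)
    (F : two_functor C D) (FW : maps_into F W (@quasiequivalences D))
    (X Y Y' : C) (r : hom Y Y') (f g : hom X Y) (s : homotopy_seq W f g) :
  hat_seq FW (seq_lwhisk r s) = Flwhisk r (hat_seq FW s).
Proof.
elim: s => [k H|k l H s IH] /=; rewrite hat_homotopy_lwhisk //.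
by rewrite IH Flwhisk_comp.
Qed.

Lemma hat_seq_rwhisk (C D : bicategory) (W : arrow_family C)
    (F : two_functor C D) (FW : maps_into F W (@quasiequivalences D))
    (X' X Y : C) (f g : hom X Y) (s : homotopy_seq W f g) (l : hom X' X) :
  hat_seq FW (seq_rwhisk s l) = Frwhisk (hat_seq FW s) l.
Proof.
elim: s => [k H|k m H s IH] /=; rewrite hat_homotopy_rwhisk //.
by rewrite IH Frwhisk_comp.
Qed.

Definition Ho_cell (C : bicategory) (W : arrow_family C) (X Y : C)
    (f g : hom X Y) : Type :=
  quotient (@seq_equiv C W X Y f g).

Definition Ho_class (C : bicategory) (W : arrow_family C) (X Y : C)
    (f g : hom X Y) (s : homotopy_seq W f g) : Ho_cell W f g :=
  class_of (@seq_equiv C W X Y f g) s.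

Lemma Ho_class_eq (C : bicategory) (W : arrow_family C) (X Y : C)
    (f g : hom X Y) (s t : homotopy_seq W f g) :
  Ho_class s = Ho_class t <-> seq_equiv s t.
Proof.
apply: eq_class => [x|x y xy|x y z xy yz] D F FW //.
by rewrite xy yz.
Qed.

Definition Ho_of_cell (C : bicategory) (W : arrow_family C)
    (Wid : contains_identities W) (X Y : C) (f g : hom X Y) (mu : f ==> g) :
    Ho_cell W f g :=
  Ho_class (seq_one (cell_homotopy Wid mu)).

(** The operations are computed on representatives; [Ho_vcompE], [Ho_lwhiskE]
    and [Ho_rwhiskE] give their values on arbitrary classes. *)
Definition Ho_vcomp (C : bicategory) (W : arrow_family C) (X Y : C)
    (f g h : hom X Y) (t : Ho_cell W g h) (s : Ho_cell W f g) :
    Ho_cell W f h :=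
  Ho_class (seq_cat (repr t) (repr s)).

Definition Ho_lwhisk (C : bicategory) (W : arrow_family C) (X Y Y' : C)
    (r : hom Y Y') (f g : hom X Y) (s : Ho_cell W f g) :
    Ho_cell W (r ** f) (r ** g) :=
  Ho_class (seq_lwhisk r (repr s)).

Definition Ho_rwhisk (C : bicategory) (W : arrow_family C) (X' X Y : C)
    (f g : hom X Y) (s : Ho_cell W f g) (l : hom X' X) :
    Ho_cell W (f ** l) (g ** l) :=
  Ho_class (seq_rwhisk (repr s) l).

Definition hat_cell (C D : bicategory) (W : arrow_family C)
    (F : two_functor C D) (FW : maps_into F W (@quasiequivalences D))
    (X Y : C) (f g : hom X Y) (s : Ho_cell W f g) : F1 F f ==> F1 F g :=
  hat_seq FW (repr s).

Lemma hat_class (C D : bicategory) (W : arrow_family C)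
    (F : two_functor C D) (FW : maps_into F W (@quasiequivalences D))
    (X Y : C) (f g : hom X Y) (s : homotopy_seq W f g) :
  hat_cell FW (Ho_class s) = hat_seq FW s.
Proof. by have /Ho_class_eq := reprK (Ho_class s); apply. Qed.

Lemma Ho_cell_ext (C : bicategory) (W : arrow_family C) (X Y : C)
    (f g : hom X Y) (s t : Ho_cell W f g) :
  (forall (D : bicategory) (F : two_functor C D)
          (FW : maps_into F W (@quasiequivalences D)),
      hat_cell FW s = hat_cell FW t) -> s = t.
Proof. by move=> e; rewrite -(reprK s) -(reprK t); apply/Ho_class_eq. Qed.

Lemma hat_vcomp (C D : bicategory) (W : arrow_family C)
    (F : two_functor C D) (FW : maps_into F W (@quasiequivalences D))
    (X Y : C) (f g h : hom X Y) (t : Ho_cell W g h) (s : Ho_cell W f g) :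
  hat_cell FW (Ho_vcomp t s) = hat_cell FW t \; hat_cell FW s.
Proof. by rewrite hat_class hat_seq_cat. Qed.

Lemma hat_lwhisk (C D : bicategory) (W : arrow_family C)
    (F : two_functor C D) (FW : maps_into F W (@quasiequivalences D))
    (X Y Y' : C) (r : hom Y Y') (f g : hom X Y) (s : Ho_cell W f g) :
  hat_cell FW (Ho_lwhisk r s) = Flwhisk r (hat_cell FW s).
Proof. by rewrite hat_class hat_seq_lwhisk. Qed.

Lemma hat_rwhisk (C D : bicategory) (W : arrow_family C)
    (F : two_functor C D) (FW : maps_into F W (@quasiequivalences D))
    (X' X Y : C) (f g : hom X Y) (s : Ho_cell W f g) (l : hom X' X) :
  hat_cell FW (Ho_rwhisk s l) = Frwhisk (hat_cell FW s) l.
Proof. by rewrite hat_class hat_seq_rwhisk. Qed.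

Lemma hat_of_cell (C D : bicategory) (W : arrow_family C)
    (Wid : contains_identities W)
    (F : two_functor C D) (FW : maps_into F W (@quasiequivalences D))
    (X Y : C) (f g : hom X Y) (mu : f ==> g) :
  hat_cell FW (Ho_of_cell Wid mu) = F2 F mu.
Proof. by rewrite hat_class /= hat_cell_homotopy. Qed.

Definition hatE := (hat_vcomp, hat_lwhisk, hat_rwhisk, hat_of_cell).

Lemma Ho_vcompE (C : bicategory) (W : arrow_family C) (X Y : C)
    (f g h : hom X Y) (t : homotopy_seq W g h) (s : homotopy_seq W f g) :
  Ho_vcomp (Ho_class t) (Ho_class s) = Ho_class (seq_cat t s).
Proof.
by apply: Ho_cell_ext => D F FW; rewrite hat_vcomp !hat_class hat_seq_cat.
Qed.

Lemma Ho_lwhiskE (C : bicategory) (W : arrow_family C) (X Y Y' : C)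
    (r : hom Y Y') (f g : hom X Y) (s : homotopy_seq W f g) :
  Ho_lwhisk r (Ho_class s) = Ho_class (seq_lwhisk r s).
Proof.
by apply: Ho_cell_ext => D F FW; rewrite hat_lwhisk !hat_class hat_seq_lwhisk.
Qed.

Lemma Ho_rwhiskE (C : bicategory) (W : arrow_family C) (X' X Y : C)
    (f g : hom X Y) (s : homotopy_seq W f g) (l : hom X' X) :
  Ho_rwhisk (Ho_class s) l = Ho_class (seq_rwhisk s l).
Proof.
by apply: Ho_cell_ext => D F FW; rewrite hat_rwhisk !hat_class hat_seq_rwhisk.
Qed.

Definition Ho (C : bicategory) (W : arrow_family C)
    (Wid : contains_identities W) : bicategory.
Proof.
refine (@Bicategory (ob C) (@hom C) (@Ho_cell C W) (@id1 C) (@comp1 C)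
  (fun X Y f => Ho_of_cell Wid (id2 f)) (@Ho_vcomp C W)
  (@Ho_lwhisk C W) (@Ho_rwhisk C W)
  (fun X Y Z T h g f => Ho_of_cell Wid (assoc h g f))
  (fun X Y Z T h g f => Ho_of_cell Wid (assocV h g f))
  (fun X Y f => Ho_of_cell Wid (lunit f))
  (fun X Y f => Ho_of_cell Wid (lunitV f))
  (fun X Y f => Ho_of_cell Wid (runit f))
  (fun X Y f => Ho_of_cell Wid (runitV f))
  _ _ _ _ _ _ _ _ _ _ _ _ _ _ _ _ _ _ _ _ _);
  intros; apply: Ho_cell_ext => D F FW; rewrite !hatE ?F2_id.
- exact: vcomp_idl.
- exact: vcomp_idr.
- exact: vcompA.
- by rewrite -F2_id Flwhisk_F2 lwhisk_id F2_id.
- exact: Flwhisk_comp.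
- by rewrite -F2_id Frwhisk_F2 rwhisk_id F2_id.
- exact: Frwhisk_comp.
- exact: F_exchange.
- by rewrite -F2_comp assocK F2_id.
- by rewrite -F2_comp assocVK F2_id.
- by rewrite -F2_comp lunitK F2_id.
- by rewrite -F2_comp lunitVK F2_id.
- by rewrite -F2_comp runitK F2_id.
- by rewrite -F2_comp runitVK F2_id.
- exact: F_assoc_lwhisk.
- exact: F_assoc_mwhisk.
- exact: F_assoc_rwhisk.
- exact: F_lunit_nat.
- exact: F_runit_nat.
- by rewrite Flwhisk_F2 Frwhisk_F2 -F2_comp triangle.
- by rewrite Flwhisk_F2 Frwhisk_F2 -!F2_comp pentagon.
Defined.

Definition Ho_incl_pseudo (C : bicategory) (W : arrow_family C)
    (Wid : contains_identities W) : pseudofunctor C (Ho Wid).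
Proof.
refine (@Pseudofunctor C (Ho Wid) (fun X => X) (fun X Y f => f)
  (fun X Y f g mu => Ho_of_cell Wid mu)
  (fun X Y Z g f => iso2_id (C := Ho Wid) (g ** f : @hom (Ho Wid) X Z))
  (fun X => iso2_id (C := Ho Wid) (id1 X : @hom (Ho Wid) X X))
  _ _ _ _ _ _ _) => //=; intros; apply: Ho_cell_ext => D F FW;
  rewrite !hatE ?F2_id ?vcomp_idr ?vcomp_idl //.
- exact: F2_comp.
- by rewrite Flwhisk_F2.
- by rewrite Frwhisk_F2.
- by rewrite -!F2_id Flwhisk_F2 Frwhisk_F2 lwhisk_id rwhisk_id !F2_id !(vcomp_idl, vcomp_idr).
- by rewrite -!F2_id Frwhisk_F2 rwhisk_id F2_id vcomp_idr.
- by rewrite -!F2_id Flwhisk_F2 lwhisk_id F2_id vcomp_idr.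
Defined.

Definition Ho_incl (C : bicategory) (W : arrow_family C)
    (Wid : contains_identities W) : two_functor C (Ho Wid) :=
  @TwoFunctor C (Ho Wid) (Ho_incl_pseudo Wid)
    (fun X Y Z g f => IsIdentity2 (C := Ho Wid) (g ** f : @hom (Ho Wid) X Z))
    (fun X => IsIdentity2 (C := Ho Wid) (id1 X : @hom (Ho Wid) X X)).

(* Main.v *)
From Stdlib Require Import ssreflect.
Require Import Defs.

(** If [r ** s] is isomorphic to an identity and [r] is in [W], then
    [(s ** r, id, r)] is a cylinder on the codomain of [s] with [r] as its weak
    arrow.  Any cylinder gives a 2-cell [d0 ==> d1] of [Ho], with the flipped
    cylinder as inverse; here this is an isomorphism of [s ** r] with the
    identity.  By 3 for 2, [r] is in [W] as soon as [s] is. *)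

Set Implicit Arguments.
Unset Strict Implicit.
Unset Printing Implicit Defensive.

Local Open Scope bicat_scope.

Definition iso2_inv (C : bicategory) (X Y : C) (f g : hom X Y)
    (u : iso2 f g) : iso2 g f :=
  Iso2 (bwdK u) (fwdK u).

Definition iso2_comp (C : bicategory) (X Y : C) (f g h : hom X Y)
    (v : iso2 g h) (u : iso2 f g) : iso2 f h.
Proof.
apply: (@Iso2 C X Y f h (v \; u) (bwd u \; bwd v)).
- by rewrite vcompA (vcomp_cancel (fwdK v)) fwdK.
- by rewrite vcompA (vcomp_cancel (bwdK u)) bwdK.
Defined.

Lemma isomorphic2_F2 (C D : bicategory) (F : pseudofunctor C D) (X Y : C)
    (f g : hom X Y) :
  isomorphic2 f g -> isomorphic2 (F1 F f) (F1 F g).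
Proof.
case=> u; constructor; apply: (@Iso2 D _ _ _ _ (F2 F u) (F2 F (bwd u))).
- by rewrite -F2_comp fwdK F2_id.
- by rewrite -F2_comp bwdK F2_id.
Qed.

Section Cylinders.

Variables (C : bicategory) (W : arrow_family C).

Definition cylinder_flip (X : C) (K : cylinder W X) : cylinder W X :=
  @Cylinder C W X _ _ (d1 K) (d0 K) (cylx K) (cyls K)
    (alpha1 K) (alpha0 K) (cyls_in K).

(** Taking [h] to be an identity makes the hat of this homotopy the hat of [K] itself, so that [K]
    yields a 2-cell of [Ho] between its two ends. *)
Definition cylinder_homotopy (X : C) (K : cylinder W X) :
    homotopy W (d0 K) (d1 K) :=
  @Homotopy C W X _ _ _ K (id1 _) (lunitV (d0 K)) (lunit (d1 K)).

(** Whiskering with the quasiequivalence [F1 F (cyls K)] is faithful, and it turns the composite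
    into the image of [alpha (cylinder_flip K) \; alpha K], where everything cancels. *)
Lemma hat_cylinder_flip (D : bicategory) (F : two_functor C D)
    (FW : maps_into F W (@quasiequivalences D)) (X : C) (K : cylinder W X) :
  hat_cylinder FW (cylinder_flip K) \; hat_cylinder FW K = id2 _.
Proof.
have [post _] := FW _ _ _ (cyls_in K).
have [faithful _] := post _ (F1 F (d0 K)) (F1 F (d0 K)).
apply: faithful; rewrite lwhisk_comp lwhisk_id.
have := hat_cylinderP FW (cylinder_flip K).
rewrite /is_hat_cylinder /= => ->; rewrite hat_cylinderP !vcompA.
rewrite (vcomp_cancel (bwdK _)) (vcomp_tail (eq_sym (F2_comp _ _ _))).
have -> : alpha (cylinder_flip K) \; alpha K = id2 _.
  by rewrite /alpha /= vcompA (vcomp_cancel (bwdK _)) fwdK.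
by rewrite F2_id vcomp_idl fwdK.
Qed.

Lemma hat_cylinder_homotopy (D : bicategory) (F : two_functor C D)
    (FW : maps_into F W (@quasiequivalences D)) (X : C) (K : cylinder W X) :
  hat_homotopy FW (cylinder_homotopy K) = hat_cylinder FW K.
Proof.
rewrite /hat_homotopy /= -FlwhiskE (vcomp_tail (F_lunit_nat _)) vcompA.
by rewrite -F2_comp lunitVK F2_id vcomp_idr.
Qed.

Variable Wid : contains_identities W.

Lemma Ho_cylinder_flip (X : C) (K : cylinder W X) :
  Ho_vcomp (Ho_class (seq_one (cylinder_homotopy (cylinder_flip K))))
           (Ho_class (seq_one (cylinder_homotopy K)))
  = Ho_of_cell Wid (id2 (d0 K)).
Proof.
apply: Ho_cell_ext => D F FW; rewrite !hatE !hat_class /=.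
rewrite hat_cylinder_homotopy F2_id -(hat_cylinder_flip FW K).
congr (_ \; _); exact: (hat_cylinder_homotopy FW (cylinder_flip K)).
Qed.

Lemma Ho_cylinder_isomorphic2 (X : C) (K : cylinder W X) :
  isomorphic2 (F1 (Ho_incl Wid) (d0 K)) (F1 (Ho_incl Wid) (d1 K)).
Proof.
(* Once [K] is a constructor, flipping it twice computes back to [K], so the second inverse law is
   the first one for the flipped cylinder. *)
case: K => W0 Z0 e0 e1 x s u v Ws; set K := Cylinder u v Ws.
constructor; apply: (@Iso2 (Ho Wid) _ _ _ _
  (Ho_class (seq_one (cylinder_homotopy K)))
  (Ho_class (seq_one (cylinder_homotopy (cylinder_flip K))))).
- exact: (Ho_cylinder_flip K).
- exact: (Ho_cylinder_flip (Cylinder v u Ws)).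
Qed.

Definition assoc_iso (X Y Z T : C) (h : hom Z T) (g : hom Y Z) (f : hom X Y) :
    iso2 (h ** g ** f) (h ** (g ** f)) :=
  Iso2 (assocK h g f) (assocVK h g f).

Definition runit_iso (X Y : C) (f : hom X Y) : iso2 (f ** id1 X) f :=
  Iso2 (runitK f) (runitVK f).

(** The 2-cell at [s ** r] rebrackets [r ** (s ** r)] so that [u] can contract [r ** s]. *)
Definition split_cylinder (X Y : C) (s : hom X Y) (r : hom Y X)
    (u : iso2 (r ** s) (id1 X)) (Wr : W r) : cylinder W Y :=
  @Cylinder C W Y Y X (s ** r) (id1 Y) r r
    (iso2_comp (lunit_iso r)
      (iso2_comp (rwhisk_iso2 u r) (iso2_inv (assoc_iso r s r))))
    (runit_iso r) Wr.

Lemma Ho_split_isomorphic2 (X Y : C) (s : hom X Y) (r : hom Y X) :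
  isomorphic2 (r ** s) (id1 X) -> W r ->
  isomorphic2 (F1 (Ho_incl Wid) (s ** r)) (F1 (Ho_incl Wid) (id1 Y)).
Proof. by case=> u Wr; exact: (Ho_cylinder_isomorphic2 (split_cylinder u Wr)). Qed.

End Cylinders.

Theorem proposition3p51 (C : bicategory) (W : arrow_family C)
    (Wid : contains_identities W) (W32 : three_for_two W)
    (X Y : C) (f : hom X Y) (Wf : W X Y f) (f_split : is_split f) :
  is_equivalence (F1 (Ho_incl Wid) f).
Proof.
case: f_split => -[g gf]; exists g.
(* Here [f] is the section: [f] and the identity are in [W], hence so is the retraction [g]. *)
- have [_ [Wg _]] := W32 _ _ _ _ _ _ gf.
  split; first exact: (isomorphic2_F2 (Ho_incl Wid) gf).
  exact: (Ho_split_isomorphic2 Wid gf (Wg Wf (Wid X))).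
(* Here [f] is itself the retraction and serves directly as the weak arrow of the cylinder. *)
- split; last exact: (isomorphic2_F2 (Ho_incl Wid) gf).
  exact: (Ho_split_isomorphic2 Wid gf Wf).
Qed.
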